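(* Let $0<\lambda\le\Lambda$, $\rho=\Lambda/\lambda$, and let $n\in\mathbb{N}$. Let $f_n$ be the strategy defined in the context, with parameters $a_0,\dots,a_{n-1}$ and $a_n=\rho$. Then: (1) for all $0\le i<n$, $a_i=p_i(a_0)$; (2) $a_0$ is the unique solution of the equation $p_n(x)=\rho$ satisfying $x>\alpha_n$; (3) $a_n=p_n(a_0)=\rho$; (4) $CR(f_n)=2a_0+1$.
   Context: Search on a line: fix reals $0<\lambda\le\Lambda$ and put $\rho=\Lambda/\lambda\ge 1$. A searcher starts at the origin of the real line; a target lies at unknown distance $D\in[\lambda,\Lambda]$ from the origin on an unknown side. A search strategy is a function $f:\mathbb{N}\to\mathbb{R}^+$ ($\mathbb{N}=\{0,1,2,\dots\}$): in iteration $i=0,1,2,\dots$ the searcher walks distance $f(i)$ from the origin, alternating directions (right for even $i$, left for odd $i$), and returns to the origin, until it reaches the target. For $D>0$ let $f^{-1}(D)$ be the smallest $j$ with $f(j)\ge D$, and let $\phi(f,D)=2\sum_{i=0}^{f^{-1}(D)}f(i)+D$. The competitive ratio is $CR(f)=\sup_{D\in[\lambda,\Lambda]}\phi(f,D)/D$. Polynomials: $p_0(x)=x$, $p_1(x)=x(x-1)$, and $p_i(x)=x\,(p_{i-1}(x)-p_{i-2}(x))$ for $i\ge 2$; $\alpha_i$ denotes the largest real root of $p_i$. The strategy $f_n$: set $a_n:=\rho$; $f_n(i)=a_i\lambda$ for $0\le i<n$ and $f_n(i)=\rho\lambda=\Lambda$ for $i\ge n$, where for $n\ge1$ the reals $1\le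 a_0\le a_1\le\cdots\le a_{n-1}\le\rho$ are such that the worst-case ratio is equal on every subinterval $[\lambda,a_0\lambda],(a_0\lambda,a_1\lambda],\dots,(a_{n-1}\lambda,\rho\lambda]$, i.e. they satisfy $1+2\sum_{k=0}^{i+1}a_k/a_i=2a_0+1$ for $0\le i\le n-2$, and $1+2\sum_{k=0}^{n-1}a_k/a_{n-1}+2\rho/a_{n-1}=2a_0+1$. For $n=0$, $f_0(i)=\Lambda$ for all $i$ and $a_0=a_n=\rho$. *)

(* Defs.v *)
From HB Require Import structures.
From mathcomp Require Import all_boot all_order all_algebra.
From mathcomp Require Import all_classical all_reals all_analysis.
From mathcomp Require Import lra.
From mathcomp Require polyrcf.

Set Implicit Arguments.
Unset Strict Implicit.
Unset Printing Implicit Defensive.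

Import Order.TTheory GRing.Theory Num.Theory.
Import numFieldNormedType.Exports.

Local Open Scope classical_set_scope.
Local Open Scope ring_scope.

Section Search.
Variable R : realType.
Implicit Types (f a : nat -> R) (lambda Lambda rho D : R) (n i : nat).

(* [None] when no iteration of [f] goes as far as [D]. *)
Definition first_reach f D : option nat :=
  match pselect (exists j, D <= f j) with
  | left e => Some (ex_minn e)
  | right _ => None
  end.

(* A target that is never reached costs [+oo]. *)
Definition phi f D : \bar R :=
  if first_reach f D is Some j then (2 * (\sum_(i < j.+1) f i) + D)%:E
  else +oo%E.

Definition CR lambda Lambda f : \bar R :=
  ereal_sup [set (phi f D / D%:E)%E | D in `[lambda, Lambda]].

Fixpoint p_poly i : {poly R} :=
  match i with
  | 0 => 'X
  | k.+1 => match k with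
            | 0 => 'X * ('X - 1)
            | j.+1 => 'X * (p_poly k - p_poly j)
            end
  end.

Definition is_largest_root (p : {poly R}) (x : R) : Prop :=
  root p x /\ forall y, root p y -> y <= x.

(* The default value 0 of [xget] is never used: see [alphaP]. *)
Definition alpha i : R := xget 0 [set x | is_largest_root (p_poly i) x].

(* Only [a 0, ..., a n] matter; [a n] is rho, so the case [i = n.-1] of the
   monotonicity condition says that [a n.-1 <= rho]. *)
Definition fn_params rho n a : Prop :=
  a n = rho /\
  ((0 < n)%N ->
   [/\ 1 <= a 0%N,
       forall i, (i < n)%N -> a i <= a i.+1,
       forall i, (i.+1 < n)%N ->
         1 + 2 * (\sum_(k < i.+2) a k / a i) = 2 * a 0%N + 1
     & 1 + 2 * (\sum_(k < n) a k / a n.-1) + 2 * rho / a n.-1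
         = 2 * a 0%N + 1]).

Definition fn lambda rho n a : nat -> R :=
  fun i => if (i < n)%N then a i * lambda else rho * lambda.

Lemma fn_gt0 lambda rho n a i : 0 < lambda -> 1 <= rho ->
  fn_params rho n a -> 0 < fn lambda rho n a i.
Proof.
move=> l0 r1 [an h]; rewrite /fn; case: ifP => [lt_in|_].
  have n0 : (0 < n)%N by apply: leq_ltn_trans lt_in.
  have [a0 mono _ _] := h n0; rewrite mulr_gt0 //.
  apply: (lt_le_trans ltr01).
  elim: i lt_in => [//|i IH] lt_in.
  by rewrite (le_trans (IH (ltnW lt_in))) // mono // ltnW.
by rewrite mulr_gt0 // (lt_le_trans ltr01).
Qed.

Lemma p_poly_neq0 i : p_poly i != 0.
Proof.
have H : 0 < (p_poly i).[4] /\ 2 * (p_poly i).[4] <= (p_poly i.+1).[4].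
  elim: i => [|i [IH1 IH2]]; first by rewrite /= !hornerE; lra.
  split; first by lra.
  have -> : p_poly i.+2 = 'X * (p_poly i.+1 - p_poly i) by [].
  rewrite hornerM hornerX hornerD hornerN; lra.
by apply/eqP => p0; case: H; rewrite p0 horner0 ltxx.
Qed.

Lemma root_p_poly0 i : root (p_poly i) 0.
Proof.
by apply/rootP; case: i => [|[|i]]; rewrite /= ?hornerM hornerX ?mul0r.
Qed.

Lemma alphaP i : is_largest_root (p_poly i) (alpha i).
Proof.
apply: (@xgetPex _ 0 [set x | is_largest_root (p_poly i) x]).
have inr x : (x \in polyrcf.rootsR (p_poly i)) = root (p_poly i) x.
  by have := polyrcf.roots_on_rootsR (p_poly_neq0 i) x; rewrite in_itv.
exists (\big[Num.max/0]_(x <- polyrcf.rootsR (p_poly i)) x); split.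
  rewrite big_seq; apply: (big_ind (fun x => root (p_poly i) x)) =>
    [|x y rx ry|x].
  - exact: root_p_poly0.
  - by case: leP.
  - by rewrite inr.
move=> y; rewrite -inr => yr.
elim: (polyrcf.rootsR _) yr => // z s IH; rewrite inE big_cons le_max.
by case/predU1P => [->|/IH ->]; rewrite ?lexx ?orbT.
Qed.

End Search.

Arguments p_poly R i : clear implicits.
Arguments alpha R i : clear implicits.

(* Main.v *)
(** Clearing denominators, the equal-ratio equations say that
    [a 0 + ... + a i.+1 = a 0 * a i] for all [i < n] (with [a n = rho]).
    Subtracting consecutive ones gives the recurrence of the polynomials [p_i]
    at [a 0].  Since [p_i.+2 (alpha_i.+1) = - alpha_i.+1 * p_i (alpha_i.+1)],
    the roots [alpha_i] are nondecreasing, so [p_0, ..., p_n] are all positive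
    to the right of [alpha_n].  The quotient [q_i x = p_i.+1 x / (x * p_i x)]
    satisfies [q_i.+1 x = 1 - 1 / (x * q_i x)], so it is nondecreasing to the
    right of [alpha_i].  Hence [q_i] stays positive there once it is positive,
    and this turns the positivity of all [p_i] at [a 0] into [alpha_n < a 0].
    Moreover [p_n] is [x] times the product of the [x * q_i x], so it is
    increasing, hence injective, to the right of [alpha_n].  The competitive
    ratio is attained at the nearest target, [D = lambda]. *)

Require Import Defs.
From HB Require Import structures.
From mathcomp Require Import all_boot all_order all_algebra.
From mathcomp Require Import all_classical all_reals all_analysis.
From mathcomp Require Import lra.
From mathcomp Require polyrcf.

Set Implicit Arguments.
Unset Strict Implicit.
Unset Printing Implicit Defensive.

Import Order.TTheory GRing.Theory Num.Theory.
Local Open Scope ring_scope.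

Section LargestRoot.
Variables (R : realType) (p : {poly R}) (z : R).
Hypotheses (p_lc_gt0 : 0 < lead_coef p) (p_z : is_largest_root p z).

Lemma horner_gt0_largest_root x : z < x -> 0 < p.[x].
Proof.
move=> zx; rewrite -sgr_cp0 (@polyrcf.sgp_pinftyP _ x).
- by rewrite /polyrcf.sgp_pinfty gtr0_sg.
- move=> y; rewrite in_itv /= andbT => xy.
  by apply/negP => /p_z.2; rewrite leNgt (lt_le_trans zx xy).
- by rewrite in_itv /= lexx.
Qed.

Lemma horner_ge0_largest_root x : z <= x -> 0 <= p.[x].
Proof.
rewrite le_eqVlt => /predU1P[<-|/horner_gt0_largest_root/ltW//].
by have [/rootP->] := p_z.
Qed.

Lemma le_largest_root x : p.[x] <= 0 -> x <= z.
Proof. by apply: contraLR; rewrite -!ltNge => /horner_gt0_largest_root. Qed.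

End LargestRoot.

Section PPoly.
Variable R : realType.
Implicit Types (x y : R) (a : nat -> R) (i n : nat).

Local Notation p i x := ((p_poly R i).[x]).

Lemma p_polySS i : p_poly R i.+2 = (p_poly R i.+1 - p_poly R i) * 'X.
Proof. by rewrite mulrC. Qed.

Lemma horner_p0 x : p 0%N x = x.
Proof. by rewrite /= hornerX. Qed.

Lemma horner_p1 x : p 1%N x = x * (x - 1).
Proof. by rewrite /= !hornerE. Qed.

Lemma horner_pSS i x : p i.+2 x = x * (p i.+1 x - p i x).
Proof. by rewrite p_polySS hornerMX mulrC hornerD hornerN. Qed.

Lemma size_p_poly i : size (p_poly R i) = i.+2.
Proof.
elim/ltn_ind: i => -[_|[_|i IH]]; first by rewrite size_polyX.
  by rewrite /= mulrC size_mulX ?polyXsubC_eq0 // size_XsubC.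
have size_diff : size (p_poly R i.+1 - p_poly R i) = i.+3.
  by rewrite size_polyDl ?size_polyN !IH.
by rewrite p_polySS size_mulX ?size_diff // -size_poly_gt0 size_diff.
Qed.

Lemma lead_coef_p_poly i : lead_coef (p_poly R i) = 1.
Proof.
elim/ltn_ind: i => -[_|[_|i IH]]; first by rewrite lead_coefX.
  by rewrite /= mulrC lead_coefMX lead_coefXsubC.
by rewrite p_polySS lead_coefMX lead_coefDl ?size_polyN ?size_p_poly ?IH.
Qed.

Lemma p_sum_unique a n :
    (forall i, (i < n)%N -> \sum_(k < i.+2) a k = a 0%N * a i) ->
  forall i, (i <= n)%N -> a i = p i (a 0%N).
Proof.
move=> sum_a; elim/ltn_ind => -[|[|i]] IH lt_in; first by rewrite horner_p0.
  have := sum_a _ lt_in.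
  by rewrite horner_p1 !big_ord_recr big_ord0 /=; lra.
have := sum_a _ lt_in.
rewrite big_ord_recr /= sum_a 1?ltnW // horner_pSS.
by rewrite -!IH ?(ltnW lt_in) ?(ltnW (ltnW lt_in)) //; lra.
Qed.

Lemma p_gt0 i x : alpha R i < x -> 0 < p i x.
Proof.
by apply: (horner_gt0_largest_root _ (alphaP R i)); rewrite lead_coef_p_poly.
Qed.

Lemma p_ge0 i x : alpha R i <= x -> 0 <= p i x.
Proof.
by apply: (horner_ge0_largest_root _ (alphaP R i)); rewrite lead_coef_p_poly.
Qed.

Lemma le_alpha i x : p i x <= 0 -> x <= alpha R i.
Proof.
by apply: (le_largest_root _ (alphaP R i)); rewrite lead_coef_p_poly.
Qed.

Lemma p_alpha i : p i (alpha R i) = 0.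
Proof. by have [/rootP] := alphaP R i. Qed.

Lemma alpha_ge0 i : 0 <= alpha R i.
Proof. by rewrite le_alpha // (rootP (root_p_poly0 _ i)). Qed.

Lemma alpha_leS i : alpha R i <= alpha R i.+1.
Proof.
elim: i => [|i IH]; first by rewrite -[alpha R 0]horner_p0 p_alpha alpha_ge0.
rewrite le_alpha // horner_pSS p_alpha sub0r mulrN oppr_le0.
by rewrite mulr_ge0 ?alpha_ge0 ?p_ge0.
Qed.

Definition p_quot i x : R := p i.+1 x / (x * p i x).

Lemma p_quot0 x : x != 0 -> p_quot 0 x = 1 - x^-1.
Proof.
move=> x0; rewrite /p_quot horner_p1 horner_p0 -mulf_div divff // mul1r.
by rewrite mulrBl mul1r divff.
Qed.

Lemma p_quotS i x : x != 0 -> p i.+1 x != 0 ->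
  p_quot i.+1 x = 1 - (x * p_quot i x)^-1.
Proof.
move=> x0 pSi0; rewrite /p_quot horner_pSS -mulf_div divff // mul1r mulrBl.
by rewrite divff // invfM invf_div mulrA mulrA mulVf // mul1r.
Qed.

Lemma pSE i x : x != 0 -> p i x != 0 -> p i.+1 x = x * p i x * p_quot i x.
Proof. by move=> x0 pi0; rewrite mulrC /p_quot divfK // mulf_neq0. Qed.

Lemma p_quot_gt0 i x : alpha R i < x -> (0 < p_quot i x) = (0 < p i.+1 x).
Proof.
move=> ax; have x0 := le_lt_trans (alpha_ge0 i) ax.
by rewrite pmulr_lgt0 // invr_gt0 mulr_gt0 ?p_gt0.
Qed.

Lemma p_quot_le i x y : alpha R i < x -> x <= y -> p_quot i x <= p_quot i y.
Proof.
move=> ax xy; have x0 := le_lt_trans (alpha_ge0 i) ax.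
have y0 := lt_le_trans x0 xy; elim: i ax => [|i IH] ax.
  by rewrite !p_quot0 ?gt_eqF // lerD2l lerN2 lef_pV2 ?posrE.
have ax' := le_lt_trans (alpha_leS i) ax.
have qx0 : 0 < p_quot i x by rewrite p_quot_gt0 ?p_gt0.
have qxy := IH ax'; have qy0 := lt_le_trans qx0 qxy.
have pSx0 := p_gt0 ax; have pSy0 := p_gt0 (lt_le_trans ax xy).
rewrite !p_quotS ?gt_eqF // lerD2l lerN2.
rewrite lef_pV2 ?posrE ?(mulr_gt0 x0) ?(mulr_gt0 y0) //.
by rewrite ler_pM // ltW.
Qed.

Lemma alpha_lt n x : (forall i, (i <= n)%N -> 0 < p i x) -> alpha R n < x.
Proof.
elim: n => [|n IH] pos.
  by have := pos 0%N isT; rewrite -[alpha R 0]horner_p0 p_alpha horner_p0.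
have ax : alpha R n < x by apply: IH => i /leqW/pos.
rewrite ltNge; apply/negP => xa.
have : 0 < p n.+1 (alpha R n.+1).
  rewrite -p_quot_gt0 ?(lt_le_trans ax xa) //.
  by rewrite (lt_le_trans _ (p_quot_le ax xa)) // p_quot_gt0 // pos.
by rewrite p_alpha ltxx.
Qed.

Lemma p_lt n : {in `]alpha R n, +oo[ &, {homo (fun x => p n x) : x y / x < y}}.
Proof.
move=> x y; rewrite !in_itv /= !andbT.
elim: n => [|n IH] ax ay xy; first by rewrite !horner_p0.
have [x0 y0] := (le_lt_trans (alpha_ge0 _) ax, le_lt_trans (alpha_ge0 _) ay).
have ax' := le_lt_trans (alpha_leS n) ax.
have ay' := le_lt_trans (alpha_leS n) ay.
have [px0 py0] := (p_gt0 ax', p_gt0 ay').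
have qx0 : 0 < p_quot n x by rewrite p_quot_gt0 ?p_gt0.
rewrite !pSE ?gt_eqF //; apply: (@lt_le_trans _ _ (y * p n y * p_quot n x)).
  by rewrite ltr_pM2r // ltr_pM ?IH // ltW.
by rewrite ler_pM2l ?mulr_gt0 // p_quot_le // ltW.
Qed.

Lemma p_inj n : {in `]alpha R n, +oo[ &, injective (fun x => p n x)}.
Proof. exact: inc_inj_in (le_mono_in (@p_lt n)). Qed.

End PPoly.

Section CompetitiveRatio.
Variables (R : realType) (lambda Lambda : R) (f : nat -> R).
Hypothesis lambda_gt0 : 0 < lambda.
Implicit Types (D r : R) (i j n : nat).

Lemma first_reach_le n D : D <= f n ->
  exists j, [/\ first_reach f D = Some j, (j <= n)%N
    & forall i, (i < j)%N -> f i < D].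
Proof.
move=> Dn; rewrite /first_reach; case: pselect => [e|[]]; last by exists n.
case: ex_minnP => j _ j_min; exists j; split=> // [|i]; first exact: j_min.
by apply: contraTT; rewrite -leNgt -leqNgt => /j_min.
Qed.

Lemma phi_divE j D : 0 < D -> first_reach f D = Some j ->
  (phi f D / D%:E)%E = (2 * ((\sum_(i < j.+1) f i) / D) + 1)%:E.
Proof.
move=> D0 fj; rewrite /phi fj inver gt_eqF // -EFinM.
by rewrite mulrDl -mulrA divff ?gt_eqF.
Qed.

Lemma CR_ge_first : lambda <= Lambda -> lambda <= f 0%N ->
  ((2 * (f 0%N / lambda) + 1)%:E <= CR lambda Lambda f)%E.
Proof.
move=> lL lf; have [j [fj + _]] := first_reach_le lf.
rewrite leqn0 => /eqP j0; rewrite j0 in fj.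
apply: ereal_sup_ubound; exists lambda; first by rewrite /= in_itv /= lexx.
by rewrite (phi_divE _ fj) // big_ord1.
Qed.

Lemma CR_le n r : Lambda <= f n -> 0 <= r -> f 0%N <= r * lambda ->
    (forall i, (i < n)%N -> \sum_(k < i.+2) f k <= r * f i) ->
  (CR lambda Lambda f <= (2 * r + 1)%:E)%E.
Proof.
move=> Ln r0 f0 sum_f; apply: ge_ereal_sup => _ [D + <-].
rewrite /= in_itv /= => /andP[lD DL].
have D0 : 0 < D by apply: lt_le_trans lD.
have [j [fj jn below]] := first_reach_le (le_trans DL Ln).
rewrite (phi_divE D0 fj) lee_fin lerD2r ler_pM2l // ler_pdivrMr //.
case: j {fj} jn below => [_ _|i lt_in /(_ i (ltnSn i)) /ltW fiD].
  by rewrite big_ord1 (le_trans f0) // ler_wpM2l.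
by rewrite (le_trans (sum_f i lt_in)) // ler_wpM2l.
Qed.

End CompetitiveRatio.

Section Params.
Variables (R : realType) (rho : R) (n : nat) (a : nat -> R).
Hypotheses (rho_ge1 : 1 <= rho) (a_params : fn_params rho n a).

Lemma params_ge1 i : (i <= n)%N -> 1 <= a i.
Proof.
have [an ratio_eqs] := a_params.
case: (posnP n) => [n0|/ratio_eqs[a0_ge1 a_le _ _]].
  by rewrite n0 leqn0 => /eqP->; rewrite -n0 an.
by elim: i => // i IH lt_in; rewrite (le_trans (IH (ltnW lt_in))) ?a_le.
Qed.

Lemma params_sum i : (i < n)%N -> \sum_(k < i.+2) a k = a 0%N * a i.
Proof.
have [an ratio_eqs] := a_params => lt_in.
have [_ _ ratio_eq last_ratio_eq] := ratio_eqs (leq_ltn_trans (leq0n i) lt_in).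
have ai0 : a i != 0.
  by rewrite gt_eqF // (lt_le_trans ltr01) // params_ge1 1?ltnW.
suff ratioE : (\sum_(k < i.+2) a k) / a i = a 0%N by rewrite -{1}ratioE divfK.
move: lt_in; rewrite leq_eqVlt => /predU1P[iSn|lt_iSn].
  rewrite big_ord_recr /= mulrDl.
  by move: last_ratio_eq; rewrite -an -iSn /= -mulr_suml; lra.
by have := ratio_eq i lt_iSn; rewrite -mulr_suml; lra.
Qed.

Lemma params_p i : (i <= n)%N -> a i = (p_poly R i).[a 0%N].
Proof. exact/p_sum_unique/params_sum. Qed.

Lemma fnE lambda i : (i <= n)%N -> fn lambda rho n a i = a i * lambda.
Proof.
have [an _] := a_params; rewrite leq_eqVlt /fn => /predU1P[->|->//].
by rewrite ltnn an.
Qed.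

Lemma CR_fn lambda : 0 < lambda ->
  CR lambda (rho * lambda) (fn lambda rho n a) = (2 * a 0%N + 1)%:E.
Proof.
move=> lambda_gt0; have [an _] := a_params.
have a0_ge1 := params_ge1 (leq0n n).
have f0E : fn lambda rho n a 0 = a 0%N * lambda by rewrite fnE.
apply/le_anti/andP; split.
  apply: (@CR_le _ _ _ _ lambda_gt0 n); rewrite ?f0E ?fnE ?an //.
    by rewrite (le_trans ler01).
  move=> i lt_in; rewrite (fnE _ (ltnW lt_in)) mulrA -params_sum // mulr_suml.
  by apply: ler_sum => k _; rewrite fnE // (leq_trans _ lt_in) // -ltnS.
rewrite -[a 0%N in leLHS](mulfK (lt0r_neq0 lambda_gt0)) -f0E.
by apply: CR_ge_first; rewrite // ?f0E ler_peMl // ltW.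
Qed.

End Params.

Theorem theorem1 (R : realType) (lambda Lambda rho : R) (n : nat)
    (a : nat -> R)
    (lambda_gt0 : 0 < lambda) (lambda_le : lambda <= Lambda)
    (rhoE : rho = Lambda / lambda)
    (a_params : fn_params rho n a) :
  [/\ forall i : nat, (i < n)%N -> a i = (p_poly R i).[a 0%N],
      [/\ (p_poly R n).[a 0%N] = rho, alpha R n < a 0%N
        & forall x : R, (p_poly R n).[x] = rho -> alpha R n < x -> x = a 0%N],
      a n = (p_poly R n).[a 0%N] /\ (p_poly R n).[a 0%N] = rho
    & CR lambda Lambda (fn lambda rho n a) = (2 * a 0%N + 1)%:E].
Proof.
have rho_ge1 : 1 <= rho by rewrite rhoE ler_pdivlMr // mul1r.
have LambdaE : Lambda = rho * lambda by rewrite rhoE divfK // gt_eqF.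
have aE := params_p rho_ge1 a_params.
have pn : (p_poly R n).[a 0%N] = rho by rewrite -aE //; case: a_params.
have an : alpha R n < a 0%N.
  apply: alpha_lt => i i_le; rewrite -aE //.
  by rewrite (lt_le_trans ltr01) // (params_ge1 rho_ge1 a_params).
split.
- by move=> i /ltnW/aE.
- split=> // x px ax; apply: (@p_inj _ n); rewrite ?in_itv /= ?andbT //.
  by rewrite px pn.
- by split=> //; apply: aE.
- by rewrite LambdaE CR_fn.
Qed.
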